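(* Let $(X,q)$ be an asymmetric normed space whose topology is $T_1$. If the closed unit ball $B_q[0,1]=\{x\in X: q(x)\le 1\}$ is compact in the topology induced by $q$, then (1) $B_q[0,1]$ is bounded with respect to the norm $q^s$; (2) $X$ is normable by $q^s$, i.e. the norm $q^s$ and the asymmetric norm $q$ induce the same topology on $X$; and (3) $X$ is a finite-dimensional vector space.
   Context: An asymmetric norm on a real vector space $X$ is a function $q:X\to[0,\infty)$ such that $q(ax)=aq(x)$ for all $a\ge 0$, $q(x+y)\le q(x)+q(y)$, and $q(x)=q(-x)=0$ implies $x=0$. The pair $(X,q)$ is an asymmetric normed space; its topology is generated by the open balls $B_q(x,\epsilon)=\{y\in X: q(y-x)<\epsilon\}$. The associated norm is $q^s(x)=\max\{q(x),q(-x)\}$. *)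

(* Defs.v *)
From HB Require Import structures.
From mathcomp Require Import all_boot all_order all_algebra.
From mathcomp Require Import boolp classical_sets reals topology normedtype.

Set Implicit Arguments.
Unset Strict Implicit.
Unset Printing Implicit Defensive.

Import Order.TTheory GRing.Theory Num.Theory.
Import numFieldNormedType.Exports.

Local Open Scope classical_set_scope.
Local Open Scope ring_scope.

Record asym_norm (R : realType) (X : lmodType R) := AsymNorm {
  asym_norm_fun :> X -> R;
  asym_norm_ge0 : forall x, 0 <= asym_norm_fun x;
  asym_normZ : forall a x, 0 <= a ->
    asym_norm_fun (a *: x) = a * asym_norm_fun x;
  asym_normD : forall x y,
    asym_norm_fun (x + y) <= asym_norm_fun x + asym_norm_fun y;
  asym_norm_eq0 : forall x,
    asym_norm_fun x = 0 -> asym_norm_fun (- x) = 0 -> x = 0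
}.

Section AsymNorm.
Context {R : realType} {X : lmodType R}.
Implicit Types (q : asym_norm X) (x y : X) (e : R).

Definition asym_ball q x e : set X := [set y | q (y - x) < e].

Definition asym_closed_unit_ball q : set X := [set x | q x <= 1].

Definition assoc_norm q x : R := Num.max (q x) (q (- x)).

Lemma asym_norm0 q : q 0 = 0.
Proof. by rewrite -(scale0r (0 : X)) asym_normZ// mul0r. Qed.

Definition asym_balls q : set (set X) :=
  [set U | exists x e, 0 < e /\ U = asym_ball q x e].

Lemma asym_balls_cover q : \bigcup_(U in asym_balls q) U = setT.
Proof.
apply/seteqP; split=> // x _; exists (asym_ball q x 1); first by exists x, 1.
by rewrite /asym_ball/= subrr asym_norm0.
Qed.

Lemma asym_balls_join q (U V : set X) x :
  asym_balls q U -> asym_balls q V -> U x -> V x ->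
  exists W, [/\ asym_balls q W, W x & W `<=` U `&` V].
Proof.
move=> [y [e [_ ->]]] [z [d [_ ->]]]; rewrite /asym_ball/= => xy xz.
pose r := Num.min (e - q (x - y)) (d - q (x - z)).
exists (asym_ball q x r); split.
- by exists x, r; rewrite lt_min !subr_gt0 xy xz.
- by rewrite /asym_ball/= subrr asym_norm0 lt_min !subr_gt0 xy xz.
- move=> w; rewrite /asym_ball/= lt_min !ltrBrDr => /andP[wy wz].
  split=> /=; [apply: le_lt_trans wy|apply: le_lt_trans wz].
  + by rewrite -[w - y](subrKA x) asym_normD.
  + by rewrite -[w - z](subrKA x) asym_normD.
Qed.

Lemma assoc_normD q x y :
  assoc_norm q (x + y) <= assoc_norm q x + assoc_norm q y.
Proof.
rewrite /assoc_norm ge_max opprD.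
by apply/andP; split; apply: le_trans (asym_normD _ _ _) _;
  apply: lerD; rewrite le_max lexx ?orbT.
Qed.

Lemma assoc_normZ q (a : R) x : assoc_norm q (a *: x) = `|a| * assoc_norm q x.
Proof.
rewrite /assoc_norm maxr_pMr//; have [a0|a0] := leP 0 a.
  by rewrite -scalerN !asym_normZ// ger0_norm.
have Na0 : 0 <= - a by rewrite oppr_ge0 ltW.
rewrite ltr0_norm// -scaleNr -{1}[a *: x]opprK -scaleNr -scalerN !asym_normZ//.
by rewrite maxC.
Qed.

Lemma assoc_norm_eq0 q x : assoc_norm q x = 0 -> x = 0.
Proof.
rewrite /assoc_norm => q0.
have q0l : q x <= 0 by rewrite -q0 le_max lexx.
have q0r : q (- x) <= 0 by rewrite -q0 le_max lexx orbT.
by apply: (@asym_norm_eq0 _ _ q); apply/eqP; rewrite eq_le asym_norm_ge0 andbT.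
Qed.

End AsymNorm.

(* Two aliases of X: asym_space q carries the topology whose base is the family
   of open balls of q, and assoc_space q is X normed by the associated norm. *)
Definition asym_space (R : realType) (X : lmodType R) (q : asym_norm X) : Type :=
  X.

HB.instance Definition _ (R : realType) (X : lmodType R) (q : asym_norm X) :=
  GRing.Lmodule.on (asym_space q).

HB.instance Definition _ (R : realType) (X : lmodType R) (q : asym_norm X) :=
  @isBaseTopological.Build (asym_space q) (set X) (asym_balls q) id
    (asym_balls_cover q) (@asym_balls_join _ _ q).

Definition assoc_space (R : realType) (X : lmodType R) (q : asym_norm X) : Type :=
  X.

HB.instance Definition _ (R : realType) (X : lmodType R) (q : asym_norm X) :=
  GRing.Lmodule.on (assoc_space q).

HB.instance Definition _ (R : realType) (X : lmodType R) (q : asym_norm X) :=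
  @Lmodule_isNormed.Build R (assoc_space q) (assoc_norm q)
    (assoc_normD q) (assoc_normZ q) (@assoc_norm_eq0 _ _ q).

Definition finite_dim (R : realType) (X : lmodType R) : Prop :=
  exists n : nat, inhabited (Vector.axiom n X).

(* Main.v *)
(** Covering the unit ball [B] by the [q]-balls [B(w, q(-w)/2)], [w <> 0], and [B(0, 1)], a finite
    subcover gives [d > 0] with [q(-x) > d] whenever [q x = 1]: a point of [B(w, q(-w)/2)] satisfies
    [q(-x) > q(-w)/2]. Hence [q] and [q^s] are equivalent, which yields (1) and (2).

    For (3), cover [B] by finitely many balls of radius [1/2], with centers [f_i]. Iterating
    [x = f_i + y/2], [y] in [B], every [x] in [B] is a [q^s]-limit of combinations of the [f_i] with
    coefficients in [[0, 2]]; these combinations form a compact, hence closed, set, so the [f_i]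
    span [X]. *)
From HB Require Import structures.
Require Import Defs.
From mathcomp Require Import all_boot all_order all_algebra.
From mathcomp Require Import boolp classical_sets reals topology normedtype.
From mathcomp Require Import finmap lra.
Import Order.TTheory GRing.Theory Num.Theory.
Import numFieldNormedType.Exports.
Local Open Scope classical_set_scope.
Local Open Scope ring_scope.

HB.instance Definition _ (R : realType) (X : lmodType R) (q : asym_norm X) :=
  isPointed.Build (asym_space q) (0 : X).

Lemma asym_ball_center (R : realType) (X : lmodType R) (q : asym_norm X)
  (x : X) (e : R) : 0 < e -> asym_ball q x e x.
Proof. by move=> e0; rewrite /asym_ball /= subrr asym_norm0. Qed.

Lemma open_asymP (R : realType) (X : lmodType R) (q : asym_norm X) (U : set X) :
  open (U : set (asym_space q)) <->
  forall x, U x -> exists2 e, 0 < e & asym_ball q x e `<=` U.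
Proof.
split=> [[D DB <-] x [V DV Vx]|UP].
  have [y [e [e0 Ve]]] := DB _ DV; move: Vx; rewrite Ve /asym_ball /= => Vx.
  (* Recentring: by the triangle inequality the ball of this radius about [x] stays inside the basic
     ball about [y]. *)
  exists (e - q (x - y)); first by rewrite subr_gt0.
  move=> z; rewrite /asym_ball /= ltrBrDr => zx; exists V => //.
  rewrite Ve /asym_ball /=; apply: le_lt_trans zx.
  by rewrite -[z - y](subrKA x) asym_normD.
exists [set V | asym_balls q V /\ V `<=` U]; first by move=> V [].
apply/seteqP; split=> [x [V [_ VU] /VU]//|x Ux].
have [e e0 eU] := UP _ Ux.
by exists (asym_ball q x e); [split=> //; exists x, e|exact: asym_ball_center].
Qed.

Lemma open_assocP (R : realType) (X : lmodType R) (q : asym_norm X) (U : set X) :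
  open (U : set (assoc_space q)) <->
  forall x, U x -> exists2 e, 0 < e & forall y, assoc_norm q (y - x) < e -> U y.
Proof.
rewrite openE; split=> UP x Ux.
  have /(@nbhs_normP R (assoc_space q))[e /= e0 eU] := UP x Ux.
  exists e => // y yx; apply: eU; rewrite /ball_ /= distrC; exact: yx.
have [e e0 eU] := UP _ Ux; apply/(@nbhs_normP R (assoc_space q)); exists e => //= y.
rewrite /ball_ /= distrC => yx; apply: eU; exact: yx.
Qed.

(** Radii that vary with the centre serve the comparison of [q] with [assoc_norm q]; a constant
    radius serves finite dimension. *)
Lemma asym_compact_net (R : realType) (X : lmodType R) (q : asym_norm X)
  (A : set X) (r : X -> R) :
  compact (A : set (asym_space q)) -> (forall x, 0 < r x) ->
  exists s : seq X, forall x, A x -> exists2 y, y \in s & q (x - y) < r y.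
Proof.
rewrite compact_cover => cA r0.
have [|x _|D _ AD] := cA X setT (fun x => asym_ball q x (r x)).
- move=> x _; exists [set asym_ball q x (r x)]; last by rewrite bigcup_set1.
  by move=> _ ->; exists x, (r x).
- by exists x => //; exact: asym_ball_center.
- by exists (enum_fset D) => x /AD[y yD xy]; exists y.
Qed.

(** If [q x = 0], every ball about 0 contains [x], so no open set around 0 excludes [x]. *)
Lemma asym_norm_gt0 (R : realType) (X : lmodType R) (q : asym_norm X) (x : X) :
  accessible_space (asym_space q) -> x != 0 -> 0 < q x.
Proof.
move=> T1 x0; rewrite lt_def asym_norm_ge0 andbT; apply/eqP => qx0.
have [|U [oU /set_mem U0 /set_mem]] := T1 (0 : X) (x : X).
  by rewrite eq_sym.
apply.
have [e e0] := (open_asymP _ _ _ _).1 oU 0 U0; apply.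
by rewrite /asym_ball /= subr0 qx0.
Qed.

Lemma seq_pos_lower_bound (R : realType) (T : eqType) (f : T -> R) (s : seq T) :
  (forall x, 0 < f x) -> exists2 d, 0 < d & forall x, x \in s -> d <= f x.
Proof.
move=> f0; elim: s => [|x s [d d0 IH]]; first by exists 1.
exists (Num.min (f x) d); first by rewrite lt_min f0.
move=> y; rewrite inE => /predU1P[->|/IH dy]; rewrite ge_min ?lexx//.
by rewrite dy orbT.
Qed.

Lemma assoc_norm_le (R : realType) (X : lmodType R) (q : asym_norm X) :
  accessible_space (asym_space q) ->
  compact (asym_closed_unit_ball q : set (asym_space q)) ->
  exists2 C, 0 < C & forall x, assoc_norm q x <= C * q x.
Proof.
move=> T1 cB.
(* At 0 the formula [q (- x) / 2] would vanish; radius 1 is positive and still misses the unit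
   sphere. *)
pose r x := if x == 0 then 1 else q (- x) / 2.
have r0 x : 0 < r x.
  rewrite /r; case: eqVneq => // x0.
  by rewrite divr_gt0// asym_norm_gt0// oppr_eq0.
have [s sP] := asym_compact_net _ _ _ _ _ cB r0.
have [d d0 ds] := seq_pos_lower_bound _ _ _ s r0.
have sphere x : q x = 1 -> d <= q (- x).
  move=> qx; have [|w ws] := sP x; first by rewrite /asym_closed_unit_ball /= qx.
  move: (ds _ ws); rewrite /r; case: eqVneq => [->|w0] dw.
    by rewrite subr0 qx ltxx.
  have := asym_normD q (- x) (x - w); rewrite addrA addNr add0r; lra.
have opp x : d * q (- x) <= q x.
  have [->|x0] := eqVneq x 0; first by rewrite oppr0 asym_norm0 mulr0.
  have qx : 0 < q (- x) by rewrite asym_norm_gt0// oppr_eq0.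
  have iq : 0 <= (q (- x))^-1 by rewrite invr_ge0 ltW.
  (* By homogeneity, the bound on the sphere is applied to [- x] normalised. *)
  have := sphere ((q (- x))^-1 *: - x).
  rewrite asym_normZ// mulVf ?gt_eqF// => /(_ erefl).
  by rewrite -scalerN opprK asym_normZ// mulrC ler_pdivlMr.
(* The summand 1 handles [q x], and [d^-1] handles [q (- x)]. *)
exists (1 + d^-1); first by rewrite addr_gt0// invr_gt0.
move=> x; have id0 : 0 < d^-1 by rewrite invr_gt0.
have qx := asym_norm_ge0 q x; rewrite /assoc_norm ge_max mulrDl mul1r.
rewrite lerDl mulr_ge0 ?(ltW id0)//=.
apply: (@le_trans _ _ (d^-1 * q x)); last by rewrite lerDr.
by rewrite mulrC ler_pdivlMr// mulrC.
Qed.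

(** Induction on the number of generators: a linear relation makes one of them redundant; without a
    relation, taking combinations is an isomorphism from row vectors. *)
Lemma finite_dim_span (R : realType) (X : lmodType R) (n : nat)
  (f : 'I_n -> X) :
  (forall x, exists c : 'rV[R]_n, \sum_i c 0 i *: f i = x) -> finite_dim X.
Proof.
elim: n f => [|n IH] f fP.
  exists 0; constructor; exists (fun=> 0); first by move=> a x y; rewrite scaler0 addr0.
  have X0 (x : X) : x = 0 by have [c <-] := fP x; rewrite big_ord0.
  by exists (fun=> 0) => x; [rewrite [RHS]X0|rewrite [RHS]thinmx0].
have [[v [v0 fv]]|inj] := pselect (exists v : 'rV_n.+1,
    v != 0 /\ \sum_i v 0 i *: f i = 0).
  have [i vi] : exists i, v 0 i != 0.
    apply: contrapT => vN; case/eqP: v0; apply/rowP => i; rewrite mxE.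
    by apply: contrapT => /eqP vi; apply: vN; exists i.
  apply: (IH (f \o lift i)) => x; have [c <-] := fP x.
  (* Subtracting this multiple of the relation [v] kills the coefficient of [f i] without changing
     the sum. *)
  exists (\row_j (c - (c 0 i / v 0 i) *: v) 0 (lift i j)).
  transitivity (\sum_j (c - (c 0 i / v 0 i) *: v) 0 j *: f j).
    rewrite [RHS](bigD1_ord i)//= !mxE divfK// subrr scale0r add0r.
    by apply: eq_bigr => j _; rewrite mxE.
  under eq_bigr do rewrite !mxE scalerBl -scalerA.
  by rewrite sumrB -scaler_sumr fv scaler0 subr0.
have finj : injective (fun c : 'rV[R]_n.+1 => \sum_i c 0 i *: f i).
  move=> c c' /eqP; rewrite -subr_eq0 -sumrB => /eqP cc'.
  apply/eqP; rewrite -subr_eq0; apply/negPn/negP => c0; apply: inj.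
  exists (c - c'); split=> //; rewrite -[RHS]cc'.
  by apply: eq_bigr => i _; rewrite !mxE scalerBl.
have [g gP] := choice fP.
exists n.+1; constructor; exists g.
  move=> a x y; apply: finj; rewrite gP.
  under eq_bigr do rewrite !mxE scalerDl -scalerA.
  by rewrite big_split /= -scaler_sumr !gP.
by exists (fun c : 'rV[R]_n.+1 => \sum_i c 0 i *: f i) => [x|c]; [|apply: finj]; rewrite gP.
Qed.

(** A continuous image of the compact box of coefficients is compact, hence closed in a Hausdorff
    space. *)
Lemma closed_bounded_combinations (R : realType) (V : normedModType R) (n : nat)
  (f : 'I_n -> V) (a b : R) :
  closed ((fun c : 'rV[R]_n => \sum_i c 0 i *: f i) @`
    [set c : 'rV[R]_n | forall i, a <= c 0 i <= b]).
Proof.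
apply: compact_closed; first exact: norm_hausdorff.
apply: continuous_compact.
  apply: continuous_subspaceT.
  apply: continuous_big; first exact: add_continuous.
  move=> i _ c; apply: (@cvgZr_tmp _ _ _ (nbhs c)).
  exact: (@coord_continuous R 1 n 0 i).
have := @rV_compact R n (fun=> `[a, b]%classic) (fun=> @segment_compact R a b).
set A := (X in compact X).
suff -> : A = [set c | forall i, a <= c 0 i <= b] by [].
by apply/seteqP; split=> c cP i; have := cP i; rewrite /= in_itv.
Qed.

Lemma half_net_approx (R : realType) (X : lmodType R) (q : asym_norm X)
  (s : seq X) (n : nat) (x : X) :
  (forall x, q x <= 1 -> exists2 y, y \in s & q (x - y) < 2^-1) -> q x <= 1 ->
  exists2 c : 'rV[R]_(size s), forall i, 0 <= c 0 i <= 2 &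
    q (x - \sum_i c 0 i *: s`_i) <= 2^-1 ^+ n.
Proof.
move=> sP; elim: n x => [|n IH] x qx.
  exists 0; first by move=> i; rewrite mxE lexx ler0n.
  by rewrite big1 ?subr0// => i _; rewrite mxE scale0r.
have [y ys xy] := sP _ qx.
have [|c cP cx] := IH (2 *: (x - y)); first by rewrite asym_normZ//; lra.
have ltj : (index y s < size s)%N by rewrite index_mem.
pose j := Ordinal ltj.
(* The bound 2 reproduces itself: coefficients are at most 1 + 2/2. *)
exists (delta_mx 0 j + 2^-1 *: c).
  move=> i; have /andP[] := cP i; rewrite !mxE eqxx /=.
  by case: (i == j) => /=; lra.
under eq_bigr do rewrite !mxE eqxx /= scalerDl -scalerA.
rewrite big_split /= -scaler_sumr (bigD1 j)//= eqxx scale1r nth_index//.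
rewrite big1 ?addr0; last by move=> i /negPf ->; rewrite scale0r.
rewrite opprD addrA -[x - y](scalerK (a := 2)) ?pnatr_eq0// -scalerBr asym_normZ ?invr_ge0//.
by rewrite exprS ler_pM2l// invr_gt0.
Qed.

Theorem corollary3p3 (R : realType) (X : lmodType R) (q : asym_norm X)
  (T1_q : accessible_space (asym_space q))
  (compact_ball : compact (asym_closed_unit_ball q : set (asym_space q))) :
  [/\ [bounded x | x in (asym_closed_unit_ball q : set (assoc_space q))],
      forall U : set X,
        open (U : set (asym_space q)) <-> open (U : set (assoc_space q)) &
      finite_dim X].
Proof.
have [C C0 qC] := assoc_norm_le _ _ _ T1_q compact_ball.
split.
- exists C; split; first exact: num_real.
  move=> M CM x; rewrite /asym_closed_unit_ball /= => qx.
  apply: le_trans (qC x) _; apply: le_trans (ltW CM).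
  by rewrite -[leRHS]mulr1 ler_pM2l.
- move=> U; rewrite open_asymP open_assocP; split=> UP x /UP[e e0 eU].
    exists e => // y yx; apply: eU; apply: le_lt_trans yx.
    by rewrite le_max lexx.
  (* [assoc_norm q] is at most [C] times [q], so the radius shrinks by [C]. *)
  exists (e / C); first exact: divr_gt0.
  move=> y; rewrite /asym_ball /= ltr_pdivlMr// mulrC => yx.
  by apply: eU; apply: le_lt_trans yx.
- have [|s sP] := asym_compact_net _ _ _ _ (fun=> 2^-1) compact_ball.
    by move=> _; rewrite invr_gt0.
  apply: (@finite_dim_span _ _ (size s) (fun i => s`_i)) => x.
  have unit_span y : q y <= 1 ->
      exists c : 'rV[R]_(size s), \sum_i c 0 i *: s`_i = y.
    move=> qy.
    have /closure_id clK := closed_bounded_combinations _ (assoc_space q) _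
      (fun i : 'I_(size s) => s`_i) 0 2.
    suff: closure ((fun c : 'rV[R]_(size s) => \sum_i c 0 i *: (s`_i : assoc_space q)) @`
      [set c : 'rV[R]_(size s) | forall i, 0 <= c 0 i <= 2]) (y : assoc_space q).
      by rewrite -clK => -[c _ cy]; exists c.
    move=> U /nbhs_normP[e /= e0 eU].
    have [n ne] : exists n, 2^-1 ^+ n < e / C.
      (* This [n] makes [2 ^+ n] exceed [C / e], so the error is below [e] in [assoc_norm q]. *)
      exists (Num.bound (C / e)); rewrite exprVn -[e / C]invf_div.
      by rewrite ltf_pV2 ?posrE ?exprn_gt0 ?divr_gt0// upper_nthrootP.
    have [c c02 cy] := half_net_approx _ _ _ _ n _ sP qy.
    exists (\sum_i c 0 i *: s`_i); split; first by exists c.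
    apply: eU; rewrite /ball_ /=; apply: le_lt_trans (qC _) _.
    by rewrite mulrC -ltr_pdivlMr//; apply: le_lt_trans ne.
  (* Dividing by [1 + q x] brings any [x] into the unit ball, 0 included. *)
  have q1 : 0 < 1 + q x by rewrite ltr_pwDl// asym_norm_ge0.
  have [|c cx] := unit_span ((1 + q x)^-1 *: x).
    rewrite asym_normZ ?invr_ge0 ?(ltW q1)// mulrC ler_pdivrMr// mul1r; lra.
  exists ((1 + q x) *: c); under eq_bigr do rewrite mxE -scalerA.
  by rewrite -scaler_sumr cx scalerA divff ?scale1r// gt_eqF.
Qed.
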